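(* Let $d\geq 2$ be an integer and let $\alpha>2-d$ be real. There exist $A_{d,\alpha}\in\mathbb{R}$ and a function $w:\mathbb{Z}^d\setminus\{0\}\to\mathbb{R}$ such that $$\sum_{x\in \mathbb{Z}^d}|x|^\alpha|\nabla u|^2(x)\geq \sum_{x\in \mathbb{Z}^d\setminus\{0\}} w(x)\, u^2(x)\quad \text{for all } u\in C_c(\mathbb{Z}^d\setminus\{0\}),$$ and, as $|x|\to +\infty$, $$w(x) = \frac{(d-2+\alpha)^2}{4}|x|^{\alpha-2} + A_{d,\alpha}|x|^{\alpha-4} + O(|x|^{\alpha -6}).$$
   Context: $|\cdot|$ is the Euclidean norm. On $\mathbb{Z}^d$, $x\sim y$ if and only if $y=x\pm e_i$ for some $1\le i\le d$, where $(e_i)$ is the canonical basis. $C_c(\mathbb{Z}^d\setminus\{0\})$ is the set of finitely supported functions $u:\mathbb{Z}^d\to\mathbb{R}$ with $u(0)=0$, and $|\nabla u|^2(x):=\frac12\sum_{y\sim x}[u(x)-u(y)]^2$. Convention at the origin: $|0|^\alpha=0$ if $\alpha>0$, $|0|^0=1$, and for $\alpha<0$ the summand at $x=0$ on the left-hand side is omitted. *)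

(* Defs.v *)
From HB Require Import structures.
From mathcomp Require Export all_boot all_order all_algebra.
From mathcomp Require Export all_classical all_reals all_analysis.

Set Implicit Arguments.
Unset Strict Implicit.
Unset Printing Implicit Defensive.

Import Order.TTheory GRing.Theory Num.Theory.

Local Open Scope classical_set_scope.
Local Open Scope ring_scope.

Definition enorm (R : realType) (d : nat) (x : 'rV[int]_d) : R :=
  Num.sqrt (\sum_(i < d) (x 0 i)%:~R ^+ 2).

Definition lattice_adj (d : nat) (x y : 'rV[int]_d) : Prop :=
  exists i : 'I_d, y = x + delta_mx 0 i \/ y = x - delta_mx 0 i.

Definition grad_sq (R : realType) (d : nat) (u : 'rV[int]_d -> R)
    (x : 'rV[int]_d) : R :=
  2^-1 * \sum_(y \in [set y | lattice_adj x y]) (u x - u y) ^+ 2.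

Definition Cc_punctured (R : realType) (d : nat) (u : 'rV[int]_d -> R) : Prop :=
  finite_set [set x | u x != 0] /\ u 0 = 0.

(* Since [0 `^ 0 = 1] and [0 `^ a = 0] for every [a != 0], negative ones
   included, [powR] realises the convention at the origin: for [alpha < 0] the
   summand at [x = 0] vanishes.  The sum has finitely many nonzero terms when
   [u] has finite support. *)
Definition weighted_energy (R : realType) (d : nat) (alpha : R)
    (u : 'rV[int]_d -> R) : R :=
  \sum_(x \in [set: 'rV[int]_d]) enorm R x `^ alpha * grad_sq u x.

Definition bigO_at_infty (R : realType) (d : nat)
    (f g : 'rV[int]_d -> R) : Prop :=
  exists C M : R,
    forall x : 'rV[int]_d, M <= enorm R x -> `|f x| <= C * `|g x|.

(* Main.v *)
Require Import Defs.
From mathcomp Require Import all_boot all_order all_algebra.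
From mathcomp Require Import all_classical all_reals all_analysis.
From mathcomp Require Import ring lra.

Set Implicit Arguments.
Unset Strict Implicit.
Unset Printing Implicit Defensive.

Import Order.TTheory GRing.Theory Num.Theory.
Import numFieldNormedType.Exports.

Local Open Scope classical_set_scope.
Local Open Scope ring_scope.

(* Ground-state substitution.  For every positive [v] the elementary inequality
   [(s - t)^2 >= s^2 (1 - v'/v) + t^2 (1 - v/v')], summed over the edges with
   conductances [(|x|^alpha + |x'|^alpha) / 2], gives the Hardy inequality with
   weight [w x = \sum_(x' ~ x) (|x|^alpha + |x'|^alpha) / 2 * (1 - v x' / v x)].

   The radial choice [v = |x|^beta], [beta = - (d - 2 + alpha) / 2], yields the
   sharp leading term, but its next term contains the non-radial quantity
   [\sum_i x_i^4 / |x|^4].  Take instead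
   [v = |x|^beta + a (\sum_i x_i^4) |x|^(beta - 6)] at large [x] (and [v = 1]
   where this is not positive).  With [rho = 1 / |x|] and [y = +- x_i / |x|] one
   has [|x +- e_i|^2 = |x|^2 (1 + 2 y rho + rho^2)], so [w / |x|^alpha] expands in
   powers of [rho]; odd powers cancel between opposite neighbours, and the
   non-radial part of the [rho^4] coefficient is affine in [a] with slope
   [4 d + 4], hence vanishes for a suitable [a]. *)

(** * Taylor expansion of (1 + s)^p at s = 0, with remainder bounds *)

Section BinomialSeries.
Variable R : realType.
Implicit Types (p s : R) (n k : nat).

(** Generalized binomial coefficient p (p - 1) ... (p - k + 1) / k!. The recursion lowers [p]
    because differentiating (1 + s)^p does. *)
Fixpoint gbinom k p : R :=
  if k is k'.+1 then p / k'.+1%:R * gbinom k' (p - 1) else 1.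

Definition powR_rem n p s : R :=
  (1 + s) `^ p - \sum_(k < n) gbinom k p * s ^+ k.

Lemma powR_rem0 n p : powR_rem n.+1 p 0 = 0.
Proof.
rewrite /powR_rem addr0 powR1 big_ord_recl expr0 mulr1 big1 ?addr0 ?subrr//.
by move=> i _; rewrite expr0n mulr0.
Qed.

Lemma is_derive_gbinom_sum n p s :
  is_derive s 1 (fun t : R => \sum_(k < n.+1) gbinom k p * t ^+ k)
    (p * \sum_(k < n) gbinom k (p - 1) * s ^+ k).
Proof.
elim: n => [|n IH].
  rewrite big_ord0 mulr0.
  have -> : (fun t : R => \sum_(k < 1) gbinom k p * t ^+ k) = cst 1.
    by apply/funext => t; rewrite big_ord_recl big_ord0 expr0 mulr1 addr0.
  exact: is_derive_cst.
have -> : (fun t : R => \sum_(k < n.+2) gbinom k p * t ^+ k) =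
    (fun t : R => \sum_(k < n.+1) gbinom k p * t ^+ k) +
    (fun t : R => gbinom n.+1 p *: t ^+ n.+1).
  by apply/funext => t; rewrite big_ord_recr.
rewrite [X in is_derive _ _ _ X]
  (_ : _ = p * (\sum_(k < n) gbinom k (p - 1) * s ^+ k) +
    gbinom n.+1 p *: (n.+1%:R * s ^+ n *: 1)); last first.
  rewrite big_ord_recr /= mulrDr /GRing.scale /= mulr1; congr (_ + _).
  have := pnatr_eq0 R n.+1; move: (n.+1%:R) => N /= /negbT N0.
  by field.
apply: is_deriveD; apply: is_deriveZ.
by have := is_deriveX n.+1 (is_derive_id s 1); rewrite exprfctE.
Qed.

Lemma is_derive_powR_rem n p s : -1 < s ->
  is_derive s 1 (powR_rem n.+1 p) (p * powR_rem n (p - 1) s).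
Proof.
move=> s1; have s0 : 0 < 1 + s by lra.
rewrite /powR_rem mulrBr.
apply: is_deriveB; last exact: is_derive_gbinom_sum.
have D1 : is_derive s 1 (fun t : R => 1 + t) 1.
  by rewrite -[X in is_derive _ _ _ X]add0r; apply: is_deriveD.
have := @is_derive1_comp R (fun t => t `^ p) (fun t => 1 + t) s _ _
  (is_derive1_powR p s0) D1.
by rewrite mulr1 /comp.
Qed.

Lemma powR_bounded p :
  exists C, forall s, `|s| <= 2^-1 -> `|(1 + s) `^ p| <= C.
Proof.
(* Since 1/2 <= 1 + s <= 3/2, the logarithm of 1 + s is at most ln 2 in absolute value. *)
exists (2 `^ `|p|) => s; rewrite ler_norml => /andP[s1 s2].
have s0 : 0 < 1 + s by lra.
rewrite ger0_norm ?powR_ge0// /powR !gt_eqF//.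
rewrite ler_expR (le_trans (ler_norm _))// normrM ler_wpM2l//.
have l2 : ln (2^-1) = - ln 2 :> R by rewrite lnV// posrE.
rewrite ler_norml -l2 !ler_ln ?posrE//; lra.
Qed.

(** The remainder of order n + 1 has derivative p times the remainder of order n for the exponent p
    - 1, so the mean value theorem on the segment from 0 to s gains one factor s. *)
Lemma powR_remP n p :
  exists C, forall s, `|s| <= 2^-1 -> `|powR_rem n p s| <= C * `|s| ^+ n.
Proof.
elim: n p => [|n IH] p.
  have [C HC] := powR_bounded p; exists C => s /HC.
  by rewrite /powR_rem big_ord0 subr0 expr0 mulr1.
have [C HC] := IH (p - 1); exists (`|p| * `|C|) => s hs.
have [hs1 hs2] : - 2^-1 <= s /\ s <= 2^-1 by move/ler_normlP: hs => [? ?]; lra.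
have mvt : exists2 c, `|c| <= `|s| &
    powR_rem n.+1 p s = p * powR_rem n (p - 1) c * s.
  have [s0|s0] := leP 0 s.
    have [||c] := @MVT_segment R (powR_rem n.+1 p)
      (fun c => p * powR_rem n (p - 1) c) 0 s s0.
    - move=> x; rewrite in_itv /= => /andP[? ?].
      apply: is_derive_powR_rem; lra.
    - apply: derivable_within_continuous => x; rewrite in_itv /= => /andP[? ?].
      by have [] : is_derive x 1 (powR_rem n.+1 p) (p * powR_rem n (p - 1) x)
        by apply: is_derive_powR_rem; lra.
    rewrite in_itv /= => /andP[c0 cs].
    rewrite powR_rem0 !subr0 => ->; exists c => //.
    by rewrite !ger0_norm.
  have [||c] := @MVT_segment R (powR_rem n.+1 p)
    (fun c => p * powR_rem n (p - 1) c) s 0 (ltW s0).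
  - move=> x; rewrite in_itv /= => /andP[? ?].
    apply: is_derive_powR_rem; lra.
  - apply: derivable_within_continuous => x; rewrite in_itv /= => /andP[? ?].
    by have [] : is_derive x 1 (powR_rem n.+1 p) (p * powR_rem n (p - 1) x)
      by apply: is_derive_powR_rem; lra.
  rewrite in_itv /= => /andP[c0 cs].
  rewrite powR_rem0 !sub0r mulrN => /oppr_inj ->; exists c => //.
  by rewrite !ler0_norm ?lerN2// ltW.
case: mvt => c cs ->.
rewrite !normrM exprSr -!mulrA ler_wpM2l// mulrA ler_wpM2r//.
apply: le_trans (HC _ (le_trans cs hs)) _.
apply: (@le_trans _ _ (`|C| * `|c| ^+ n)); first by rewrite ler_wpM2r// ?exprn_ge0// ler_norm.
by rewrite ler_wpM2l// lerXn2r// nnegrE.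
Qed.

(* The junk quotient at [s = 0] is replaced by the limit, so that the
   recursion below holds there too. *)
Definition powR_quo n p s : R :=
  if s == 0 then gbinom n p else powR_rem n p s / s ^+ n.

Lemma powR_quo0 p s : powR_quo 0 p s = (1 + s) `^ p.
Proof.
rewrite /powR_quo /powR_rem big_ord0 subr0 expr0 divr1.
by case: eqP => // ->; rewrite addr0 powR1.
Qed.

Lemma powR_quoS n p s : powR_quo n p s = gbinom n p + s * powR_quo n.+1 p s.
Proof.
rewrite /powR_quo; case: eqP => [->|/eqP s0]; first by rewrite mul0r addr0.
by rewrite /powR_rem big_ord_recr /= exprS; field; rewrite s0 expf_neq0.
Qed.

Lemma powR_quo_bounded n p :
  exists C, forall s, `|s| <= 2^-1 -> `|powR_quo n p s| <= C.
Proof.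
have [C HC] := powR_remP n p; exists (`|gbinom n p| + `|C|) => s hs.
rewrite /powR_quo; case: eqP => [_|/eqP s0]; first by rewrite lerDl.
rewrite normrM normfV normrX ler_pdivrMr ?exprn_gt0 ?normr_gt0//.
rewrite (le_trans (HC _ hs))// ler_wpM2r ?exprn_ge0//.
by rewrite (le_trans (ler_norm _))// lerDr.
Qed.

End BinomialSeries.

(** * Expansions in powers of [rho] with bounded coefficients that depend on the point *)

Section Jets.
Variables (R : realType) (T : Type) (D : T -> Prop) (rho : T -> R).
Hypothesis rho_le1 : forall t, D t -> `|rho t| <= 1.
Implicit Types (a b : nat -> T -> R) (c f g y s : T -> R).

Definition bounded_on f := exists C, forall t, D t -> `|f t| <= C.

(* [f] agrees with [\sum_(k < n) a k * rho ^+ k] up to [O(rho ^+ n)],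
   uniformly on [D]; the coefficients may depend on the point. *)
Fixpoint jet n a f : Prop :=
  if n is n'.+1 then
    bounded_on (a 0) /\ exists2 g, jet n' (fun k => a k.+1) g &
      forall t, D t -> f t = a 0 t + rho t * g t
  else bounded_on f.

Lemma bounded_cst (x : R) : bounded_on (fun=> x).
Proof. by exists `|x|. Qed.

Lemma bounded_onD f g :
  bounded_on f -> bounded_on g -> bounded_on (fun t => f t + g t).
Proof.
move=> [C HC] [K HK]; exists (C + K) => t Dt.
by rewrite (le_trans (ler_normD _ _))// lerD ?HC ?HK.
Qed.

Lemma bounded_onM f g :
  bounded_on f -> bounded_on g -> bounded_on (fun t => f t * g t).
Proof.
move=> [C HC] [K HK]; exists (C * K) => t Dt.
by rewrite normrM ler_pM ?HC ?HK.
Qed.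

Lemma bounded_onN f : bounded_on f -> bounded_on (fun t => - f t).
Proof. by move=> [C HC]; exists C => t Dt; rewrite normrN HC. Qed.

Lemma bounded_onX f n : bounded_on f -> bounded_on (fun t => f t ^+ n).
Proof.
move=> bf; elim: n => [|n IH]; first exact: bounded_cst.
under eq_fun do rewrite exprS.
exact: bounded_onM.
Qed.

Lemma bounded_on_ext f g :
  bounded_on f -> (forall t, D t -> f t = g t) -> bounded_on g.
Proof. by move=> [C HC] fg; exists C => t Dt; rewrite -fg ?HC. Qed.

Lemma bounded_rho : bounded_on rho.
Proof. by exists 1. Qed.

Lemma jet_bounded n a f : jet n a f -> bounded_on f.
Proof.
elim: n a f => // n IH a f /= [ba [g /IH bg fE]].
apply: bounded_on_ext (fun t Dt => esym (fE t Dt)).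
by apply: bounded_onD => //; apply: bounded_onM => //; exact: bounded_rho.
Qed.

Lemma eq_jet n a b f g : jet n a f ->
  (forall k t, (k < n)%N -> D t -> a k t = b k t) ->
  (forall t, D t -> f t = g t) -> jet n b g.
Proof.
elim: n a b f g => [|n IH] a b f g /=.
  by move=> bf _; exact: bounded_on_ext.
move=> [ba [h jh fE]] ab fg; split.
  by apply: bounded_on_ext ba _ => t; exact: ab.
exists h; last by move=> t Dt; rewrite -fg// fE// ab.
by apply: IH jh _ _ => // k t kn; exact: ab.
Qed.

Lemma jetW n a f : jet n.+1 a f -> jet n a f.
Proof.
elim: n a f => [a f|n IH a f [ba [g jg fE]]]; first exact: jet_bounded.
by split=> //; exists g => //; exact: IH.
Qed.

Lemma jet0 n : jet n (fun _ _ => 0) (fun=> 0).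
Proof.
elim: n => [|n IH] /=; first exact: bounded_cst.
split; first exact: bounded_cst.
by exists (fun=> 0) => // t _; rewrite mulr0 addr0.
Qed.

Definition jcons c a : nat -> T -> R := fun k => if k is k'.+1 then a k' else c.

Lemma jet_cons n c a f : bounded_on c -> jet n a f ->
  jet n (jcons c a) (fun t => c t + rho t * f t).
Proof.
by move=> bc jf; apply: jetW; split=> //; exists f.
Qed.

Definition jcst c := jcons c (fun _ _ => 0).

Lemma jet_cst n c : bounded_on c -> jet n (jcst c) c.
Proof.
move=> bc; have := jet_cons bc (jet0 n); move/eq_jet; apply => // t _.
by rewrite mulr0 addr0.
Qed.

Lemma jetD n a b f g : jet n a f -> jet n b g ->
  jet n (fun k t => a k t + b k t) (fun t => f t + g t).
Proof.
elim: n a b f g => [|n IH] a b f g /=; first exact: bounded_onD.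
move=> [ba [f' jf fE]] [bb [g' jg gE]]; split; first exact: bounded_onD.
exists (fun t => f' t + g' t); first exact: IH jf jg.
by move=> t Dt; rewrite fE// gE//; ring.
Qed.

Lemma jetMl n c a f : bounded_on c -> jet n a f ->
  jet n (fun k t => c t * a k t) (fun t => c t * f t).
Proof.
move=> bc; elim: n a f => [|n IH] a f /=; first exact: bounded_onM.
move=> [ba [g jg fE]]; split; first exact: bounded_onM.
exists (fun t => c t * g t); first exact: IH.
by move=> t Dt; rewrite fE//; ring.
Qed.

Lemma jetN n a f : jet n a f -> jet n (fun k t => - a k t) (fun t => - f t).
Proof.
move=> jf; apply: eq_jet (jetMl (bounded_cst (-1)) jf) _ _ => *;
  by rewrite mulN1r.
Qed.

(** Cauchy product, by recursion on the first factor: if f = a0 + rho f' and g = b0 + rho g', then f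
    g = a0 b0 + rho (f' g + a0 g'). *)
Fixpoint jconv a b k t : R :=
  if k is k'.+1 then jconv (fun i => a i.+1) b k' t + a 0 t * b k'.+1 t
  else a 0 t * b 0 t.

Lemma jetM n a b f g : jet n a f -> jet n b g ->
  jet n (jconv a b) (fun t => f t * g t).
Proof.
elim: n a b f g => [|n IH] a b f g /=; first exact: bounded_onM.
move=> [ba [f' jf fE]] jg'; have /jetW jg : jet n.+1 b g by [].
case: jg' => bb [g' jg' gE]; split; first exact: bounded_onM.
exists (fun t => f' t * g t + a 0 t * g' t).
  by apply: jetD; [exact: IH|exact: jetMl].
by move=> t Dt; rewrite fE// mulrDl {1}gE//; ring.
Qed.

Lemma jet_sum n (I : finType) (a : I -> nat -> T -> R) (f : I -> T -> R) :
  (forall i, jet n (a i) (f i)) ->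
  jet n (fun k t => \sum_i a i k t) (fun t => \sum_i f i t).
Proof.
move=> jf; elim: (index_enum I) => [|i r IH].
  by apply: eq_jet (jet0 n) _ _ => *; rewrite big_nil.
by apply: eq_jet (jetD (jf i) IH) _ _ => *; rewrite big_cons.
Qed.

Lemma jet_remainder n a f : jet n a f -> exists C, forall t, D t ->
  `|f t - \sum_(k < n) a k t * rho t ^+ k| <= C * `|rho t| ^+ n.
Proof.
elim: n a f => [|n IH] a f /=.
  by move=> [C HC]; exists C => t Dt; rewrite big_ord0 subr0 expr0 mulr1 HC.
move=> [_ [g /IH[C HC] fE]]; exists C => t Dt.
rewrite fE// big_ord_recl expr0 mulr1 opprD addrACA subrr add0r.
rewrite (eq_bigr (fun i : 'I_n => rho t * (a i.+1 t * rho t ^+ i))); last first.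
  by move=> i _; rewrite /= exprS; ring.
rewrite -mulr_sumr -mulrBr normrM exprS mulrCA.
by rewrite ler_wpM2l ?HC.
Qed.

(* Coefficient of [rho ^+ k] in the [n]-th Taylor quotient of [(1 + s) `^ p] at
   [s = 2 * y * rho + rho ^+ 2]; for [n = 0], a Gegenbauer polynomial in [y]. *)
Fixpoint gegen k n (p y : R) : R :=
  match k with
  | 0 => gbinom n p
  | k1.+1 => 2 * y * gegen k1 n.+1 p y +
             (if k1 is k2.+1 then gegen k2 n.+1 p y else 0)
  end.

(** With s = rho (2 y + rho) and Q_n the n-th quotient, [powR_quoS] reads Q_n = gbinom n p + rho (2
    y Q' + rho Q'), where Q' is the next quotient; this is the recursion of [gegen]. Each order
    gained moves from n to n + 1, so n stays general in the induction. *)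
Lemma jet_powR_quo m n p y : bounded_on y ->
  (forall t, D t -> `|2 * y t * rho t + rho t ^+ 2| <= 2^-1) ->
  jet m (fun k t => gegen k n p (y t))
    (fun t => powR_quo n p (2 * y t * rho t + rho t ^+ 2)).
Proof.
move=> bY small; elim: m n => [|m IH] n /=.
  have [C HC] := powR_quo_bounded n p.
  by exists C => t Dt; rewrite HC// small.
split; first exact: bounded_cst.
pose Q t := powR_quo n.+1 p (2 * y t * rho t + rho t ^+ 2).
exists (fun t => 2 * y t * Q t + (0 + rho t * Q t)); last first.
  by move=> t Dt; rewrite powR_quoS /Q; ring.
have b2y : bounded_on (fun t => 2 * y t).
  by apply: bounded_onM => //; exact: bounded_cst.
have jQ := jet_cons (bounded_cst 0) (IH n.+1).
by apply: eq_jet (jetD (jetMl b2y (IH n.+1)) jQ) _ _ => // -[|k] t.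
Qed.

Lemma jet_powR n p y : bounded_on y ->
  (forall t, D t -> `|2 * y t * rho t + rho t ^+ 2| <= 2^-1) ->
  jet n (fun k t => gegen k 0 p (y t))
    (fun t => (1 + (2 * y t * rho t + rho t ^+ 2)) `^ p).
Proof.
move=> bY small; apply: eq_jet (jet_powR_quo n 0 p bY small) _ _ => // t _.
exact: powR_quo0.
Qed.

(** * Contribution of a single coordinate direction to the weight *)

Section Direction.
Variables (p q a : R) (s : T -> R).
Hypothesis bs : bounded_on s.

(** Contribution of one neighbour to w |x|^(-2p) (1 + a s rho^2), where [s] stands for the sum of
    the x_i^4 / |x|^4 and [G e] for the ratio of |.|^(2e) at the neighbour and at x. The factor 1 +
    a s rho^2 clears the denominator v x, so that no reciprocal has to be expanded. *)
Definition dir_term y t : R :=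
  let G e := (1 + (2 * y t * rho t + rho t ^+ 2)) `^ e in
  2^-1 * ((1 + G p) * ((1 - G q) + a * rho t ^+ 2 *
    (s t - (s t + 4 * y t ^+ 3 * rho t + 6 * y t ^+ 2 * rho t ^+ 2
            + 4 * y t * rho t ^+ 3 + rho t ^+ 4) * G (q - 3)))).

Definition quartic_coef y : nat -> T -> R :=
  jcons s (jcons (fun t => 4 * y t ^+ 3) (jcons (fun t => 6 * y t ^+ 2)
    (jcons (fun t => 4 * y t) (jcst (fun=> 1))))).

Definition dir_coef y : nat -> T -> R :=
  let G e k t := gegen k 0 e (y t) in
  fun k t => 2^-1 * jconv (fun k t => jcst (fun=> 1) k t + G p k t)
    (fun k t => jcst (fun=> 1) k t + - G q k t +
      a * jcons (fun=> 0) (jcons (fun=> 0)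
        (fun k t => jcst s k t + - jconv (quartic_coef y) (G (q - 3)) k t)) k t)
    k t.

Lemma jet_dir n y : bounded_on y ->
  (forall t, D t -> `|2 * y t * rho t + rho t ^+ 2| <= 2^-1) ->
  jet n (dir_coef y) (dir_term y).
Proof.
move=> bY small; have b0 := bounded_cst.
have bM x k : bounded_on (fun t => x * y t ^+ k).
  by apply: bounded_onM => //; exact: bounded_onX.
have b1 : bounded_on (fun t => 4 * y t) by exact: bounded_onM.
have jG e := jet_powR n e bY small.
have jq : jet n (quartic_coef y) _ :=
  jet_cons bs (jet_cons (bM 4 3) (jet_cons (bM 6 2)
    (jet_cons b1 (jet_cst n (b0 1))))).
have j1 := jet_cst n (b0 1).
have jK := jetD (jet_cst n bs) (jetN (jetM jq (jG (q - 3)))).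
have jE := jetD (jetD j1 (jetN (jG q)))
  (jetMl (b0 a) (jet_cons (b0 0) (jet_cons (b0 0) jK))).
apply: eq_jet (jetMl (b0 2^-1) (jetM (jetD j1 (jG p)) jE)) _ _ => // t _.
by rewrite /dir_term; congr (_ * (_ * _)); ring.
Qed.

Let c k e : R := gbinom k e.

(** With the next two: coefficients of 1, y^2 and y^4 in the rho^4 term of (1 + G p) (1 - G q) / 2,
    which is [dir_term] for a = 0. *)
Definition dir_k0 := - (c 2 q + p * q / 2).
Definition dir_k2 := - (12 * c 3 q + 6 * p * c 2 q + 6 * q * c 2 p).
Definition dir_k4 :=
  - (16 * c 4 q + 8 * p * c 3 q + 8 * c 2 p * c 2 q + 8 * q * c 3 p).

Definition dir_pair_coef y : nat -> T -> R := fun k t =>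
  let m := q - 3 in
  match k with
  | 2 => - 2 * q - 4 * q * (q - 1 + p) * y t ^+ 2
  | 4 => 2 * (dir_k0 + dir_k2 * y t ^+ 2 + dir_k4 * y t ^+ 4)
         - 2 * a * (s t * (m + 2 * m * (m - 1 + p) * y t ^+ 2)
                    + 6 * y t ^+ 2 + (8 * m + 4 * p) * y t ^+ 4)
  | _ => 0
  end.

(** [dir_term] is invariant under (y, rho) -> (-y, -rho). Its odd coefficients are therefore odd in
    y and cancel between opposite neighbours, while the even ones double. *)
Lemma dir_coef_pair y k t : (k < 6)%N ->
  dir_coef y k t + dir_coef (fun t => - y t) k t = dir_pair_coef y k t.
Proof.
rewrite /dir_coef /dir_pair_coef /dir_k0 /dir_k2 /dir_k4 /c.
case: k => [|[|[|[|[|[|//]]]]]] _ /=; by field.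
Qed.

End Direction.
End Jets.

(** * Norms and quartic sums at neighbouring lattice points *)

Section LatticeSteps.
Variables (R : realType) (d : nat).
Implicit Types (x : 'rV[int]_d) (i j : 'I_d) (b : bool).

Definition lattice_step i b : 'rV[int]_d :=
  if b then - delta_mx 0 i else delta_mx 0 i.

Local Notation r := (enorm R).
Local Notation coord x i := ((x 0 i)%:~R : R).

Definition quartic_sum x : R := \sum_i coord x i ^+ 4.
Definition inv_norm x : R := (r x)^-1.
Definition unit_coord i b x : R := (-1) ^+ b * (coord x i / r x).
Definition unit_quartic x : R := quartic_sum x / r x ^+ 4.
Definition step_incr i b x : R :=
  2 * unit_coord i b x * inv_norm x + inv_norm x ^+ 2.

Lemma coord_step x i b j :
  coord (x + lattice_step i b) j = coord x j + (-1) ^+ b * (j == i)%:R.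
Proof.
rewrite /lattice_step; case: b; rewrite !mxE eqxx /= rmorphD /=.
  by rewrite rmorphN /= expr1 mulN1r; case: (j == i).
by rewrite expr0 mul1r; case: (j == i).
Qed.

Lemma sum_coord_step (F : R -> R) x i b :
  \sum_j F (coord (x + lattice_step i b) j) =
  \sum_j F (coord x j) + (F (coord x i + (-1) ^+ b) - F (coord x i)).
Proof.
rewrite (bigD1 i)//= [in RHS](bigD1 i)//= coord_step eqxx mulr1.
rewrite (eq_bigr (fun j => F (coord x j))); first by ring.
by move=> j /negPf ji; rewrite coord_step ji mulr0 addr0.
Qed.

Lemma enorm_ge0 x : 0 <= r x.
Proof. exact: sqrtr_ge0. Qed.

Lemma enorm_sq x : r x ^+ 2 = \sum_i coord x i ^+ 2.
Proof. by rewrite sqr_sqrtr// sumr_ge0// => i _; rewrite sqr_ge0. Qed.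

Lemma sum_unit_coord2 b x : 0 < r x -> \sum_i unit_coord i b x ^+ 2 = 1.
Proof.
move=> r0; under eq_bigr do rewrite /unit_coord exprMn sqrr_sign mul1r exprMn.
by rewrite -mulr_suml -enorm_sq exprVn mulfV// expf_neq0// gt_eqF.
Qed.

Lemma sum_unit_coord4 b x :
  \sum_i unit_coord i b x ^+ 4 = unit_quartic x.
Proof.
rewrite /unit_quartic /quartic_sum mulr_suml; apply: eq_bigr => i _.
rewrite /unit_coord !exprMn exprVn.
by case: b; rewrite /= ?expr1 ?expr0; ring.
Qed.

Lemma unit_coord2_le1 i b x : 0 < r x -> unit_coord i b x ^+ 2 <= 1.
Proof.
move=> r0; rewrite -(sum_unit_coord2 b r0) (bigD1 i)//= lerDl.
by rewrite sumr_ge0// => j _; rewrite sqr_ge0.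
Qed.

Lemma unit_coord_le1 i b x : 0 < r x -> `|unit_coord i b x| <= 1.
Proof.
move=> r0; rewrite -(@ler_pXn2r _ 2)// ?nnegrE// expr1n.
by rewrite real_normK ?num_real// unit_coord2_le1.
Qed.

Lemma unit_quartic_ge0 x : 0 <= unit_quartic x.
Proof.
by rewrite -(sum_unit_coord4 false) sumr_ge0// => i _; rewrite exprn_even_ge0.
Qed.

Lemma unit_quartic_le1 x : 0 < r x -> unit_quartic x <= 1.
Proof.
move=> r0; rewrite -(sum_unit_coord4 false) -(sum_unit_coord2 false r0).
apply: ler_sum => i _; rewrite -[4%N]/(2 * 2)%N exprM expr2.
by rewrite ler_piMr ?sqr_ge0// unit_coord2_le1.
Qed.

Lemma inv_norm_le x (M : R) : 0 < M -> M <= r x -> inv_norm x <= M^-1.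
Proof. by move=> M0 Mr; rewrite lef_pV2// posrE (lt_le_trans M0). Qed.

(** The bound is 2/6 + 1/36 < 1/2, within the range of the binomial estimates. *)
Lemma step_incr_small i b x : 6 <= r x -> `|step_incr i b x| <= 2^-1.
Proof.
move=> r6; have r0 : 0 < r x by lra.
have r1 : inv_norm x <= 6^-1 by apply: inv_norm_le.
have r2 : 0 <= inv_norm x by rewrite invr_ge0 ltW.
have := unit_coord_le1 i b r0; rewrite !ler_norml /step_incr => /andP[y1 y2].
apply/andP; split; nra.
Qed.

Lemma enorm_step_sq i b x : 0 < r x ->
  r (x + lattice_step i b) ^+ 2 = r x ^+ 2 * (1 + step_incr i b x).
Proof.
move=> r0; rewrite enorm_sq (sum_coord_step (fun z => z ^+ 2)) -enorm_sq.
rewrite sqrrD sqrr_sign /step_incr /unit_coord /inv_norm.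
by field; rewrite gt_eqF.
Qed.

(** Exponents are kept in the form 2 e because it is the squared norm that is polynomial in the
    step. *)
Lemma enorm_step_powR i b x e : 6 <= r x ->
  r (x + lattice_step i b) `^ (2 * e) =
  r x `^ (2 * e) * (1 + step_incr i b x) `^ e.
Proof.
move=> r6; have r0 : 0 < r x by lra.
have := step_incr_small i b r6; rewrite ler_norml => /andP[h1 h2].
have sq z : 0 <= z -> z `^ (2 * e) = (z ^+ 2) `^ e.
  by move=> z0; rewrite powRrM powR_mulrn.
rewrite !sq ?enorm_ge0// enorm_step_sq// powRM ?sqr_ge0//; lra.
Qed.

Lemma quartic_sum_step i b x : 0 < r x ->
  quartic_sum (x + lattice_step i b) =
  r x ^+ 4 * (unit_quartic x + 4 * unit_coord i b x ^+ 3 * inv_norm x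
    + 6 * unit_coord i b x ^+ 2 * inv_norm x ^+ 2
    + 4 * unit_coord i b x * inv_norm x ^+ 3 + inv_norm x ^+ 4).
Proof.
move=> r0; rewrite /quartic_sum (sum_coord_step (fun z => z ^+ 4)).
rewrite -/(quartic_sum x) /unit_quartic /unit_coord /inv_norm.
by case: b; rewrite /= ?expr1 ?expr0; field; rewrite gt_eqF.
Qed.

End LatticeSteps.

(** * The ground state far from the origin and at neighbouring points *)

Section GroundState.
Variables (R : realType) (d : nat) (q a : R).
Implicit Types (x : 'rV[int]_d) (i : 'I_d) (b : bool).
Local Notation r := (enorm R).
Local Notation rho := (@inv_norm R d).
Local Notation sg := (@unit_quartic R d).

(** Here 2 q is the exponent beta. *)
Definition ground_formula x : R :=
  r x `^ (2 * q) + a * quartic_sum R x * r x `^ (2 * (q - 3)).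

Definition ground_state x : R :=
  if 0 < ground_formula x then ground_formula x else 1.

Lemma ground_state_gt0 x : 0 < ground_state x.
Proof. by rewrite /ground_state; case: ifP. Qed.

Lemma powR_enormB x e k : 0 < r x ->
  r x `^ (e - k%:R) = r x `^ e * rho x ^+ k.
Proof.
move=> r0; rewrite powRB ?(gt_eqF r0) ?implybT// powR_mulrn ?ltW//.
by rewrite exprVn.
Qed.

Lemma ground_formulaE x : 0 < r x ->
  ground_formula x = r x `^ (2 * q) * (1 + a * sg x * rho x ^+ 2).
Proof.
move=> r0; rewrite /ground_formula mulrBr -natrM powR_enormB//.
rewrite /unit_quartic /inv_norm; field; by rewrite gt_eqF.
Qed.

Lemma corrector_ge x : 1 <= r x -> 2 * `|a| <= r x ^+ 2 ->
  2^-1 <= 1 + a * sg x * rho x ^+ 2.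
Proof.
move=> r1 ra; have r0 : 0 < r x by lra.
have r2 : 0 < r x ^+ 2 by rewrite exprn_gt0.
(* As 0 <= [sg x] <= 1, the left side is at most |a| / |x|^2. *)
have h : `|a * sg x * rho x ^+ 2| <= 2^-1.
  rewrite /inv_norm exprVn normrM normfV (ger0_norm (ltW r2)) ler_pdivrMr//.
  rewrite normrM (ger0_norm (unit_quartic_ge0 _ _)).
  have := unit_quartic_le1 r0; have := unit_quartic_ge0 R x.
  have := normr_ge0 a; nra.
by move: h; rewrite ler_norml => /andP[]; lra.
Qed.

Lemma ground_stateE x : 1 <= r x -> 2 * `|a| <= r x ^+ 2 ->
  ground_state x = r x `^ (2 * q) * (1 + a * sg x * rho x ^+ 2).
Proof.
move=> r1 ra; have r0 : 0 < r x by lra.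
rewrite /ground_state ground_formulaE// ifT// mulr_gt0// ?powR_gt0//.
by have := corrector_ge r1 ra; lra.
Qed.

(** The threshold 6 + 4 |a| serves the neighbour too: its squared norm is at least |x|^2 / 2, which
    exceeds 1 and 2 |a|, so the formula is positive there. *)
Lemma ground_state_step i b x : 6 + 4 * `|a| <= r x ->
  ground_state (x + lattice_step i b) = r x `^ (2 * q) *
    ((1 + step_incr R i b x) `^ q + a * rho x ^+ 2 *
     ((sg x + 4 * unit_coord R i b x ^+ 3 * rho x
      + 6 * unit_coord R i b x ^+ 2 * rho x ^+ 2
      + 4 * unit_coord R i b x * rho x ^+ 3 + rho x ^+ 4) *
      (1 + step_incr R i b x) `^ (q - 3))).
Proof.
move=> ra; have a0 := normr_ge0 a.
have r6 : 6 <= r x by lra.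
have r0 : 0 < r x by lra.
have := step_incr_small i b r6; rewrite ler_norml => /andP[h1 h2].
have r'2 := enorm_step_sq i b r0.
have r'0 := enorm_ge0 R (x + lattice_step i b).
have r'1 : 1 <= r (x + lattice_step i b) by nra.
rewrite /ground_state ifT; last first.
  rewrite ground_formulaE; last by lra.
  rewrite mulr_gt0 ?powR_gt0//; first by lra.
  have : 2 * `|a| <= r (x + lattice_step i b) ^+ 2 by nra.
  by move/(corrector_ge r'1); lra.
rewrite /ground_formula !enorm_step_powR// quartic_sum_step//.
(* |x|^(2q - 6) is |x|^(2q) rho^4 rho^2, and rho^4 cancels the factor |x|^4 of the quartic sum. *)
rewrite (mulrBr 2 q 3) -natrM powR_enormB//.
rewrite -[rho x ^+ (2 * 3)]/(rho x ^+ (4 + 2)) exprD.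
have r4 : r x ^+ 4 * rho x ^+ 4 = 1.
  by rewrite -exprMn divff ?expr1n// gt_eqF.
rewrite [RHS]mulrDr; congr (_ + _); set S := (X in r x ^+ 4 * X); set G := _ `^ (q - 3).
transitivity (a * (r x ^+ 4 * rho x ^+ 4) * S * r x `^ (2 * q) * rho x ^+ 2 * G).
  by ring.
by rewrite r4 /S; ring.
Qed.

End GroundState.

(** * The Hardy weight of a positive function, evaluated on the ground state *)

Section HardyWeight.
Variables (R : realType) (d : nat).
Implicit Types (x : 'rV[int]_d) (i : 'I_d) (b : bool).
Local Notation r := (enorm R).

Definition hardy_weight (alpha : R) (v : 'rV[int]_d -> R) x : R :=
  \sum_i \sum_b 2^-1 * (r x `^ alpha + r (x + lattice_step i b) `^ alpha) *
    (1 - v (x + lattice_step i b) / v x).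

Lemma hardy_weight_ground_state (p q a : R) x : 6 + 4 * `|a| <= r x ->
  hardy_weight (2 * p) (ground_state q a) x *
    (1 + a * unit_quartic R x * inv_norm R x ^+ 2) =
  r x `^ (2 * p) * \sum_i
    (dir_term (@inv_norm R d) p q a (@unit_quartic R d)
       (unit_coord R i false) x +
     dir_term (@inv_norm R d) p q a (@unit_quartic R d)
       (fun x => - unit_coord R i false x) x).
Proof.
move=> ra; have a0 := normr_ge0 a.
have r6 : 6 <= r x by lra.
have r0 : 0 < r x by lra.
have r1 : 1 <= r x by lra.
have ra2 : 2 * `|a| <= r x ^+ 2 by nra.
have V0 := corrector_ge r1 ra2.
rewrite /hardy_weight mulr_suml mulr_sumr; apply: eq_bigr => i _.
have yT : unit_coord R i true x = - unit_coord R i false x.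
  by rewrite /unit_coord expr1 expr0 mulN1r mul1r.
rewrite big_bool [LHS]mulrDl [LHS]addrC [RHS]mulrDr.
suff H b : 2^-1 * (r x `^ (2 * p) + r (x + lattice_step i b) `^ (2 * p)) *
    (1 - ground_state q a (x + lattice_step i b) / ground_state q a x) *
    (1 + a * unit_quartic R x * inv_norm R x ^+ 2) =
    r x `^ (2 * p) * dir_term (@inv_norm R d) p q a (@unit_quartic R d)
       (unit_coord R i b) x.
  congr (_ + _); first exact: (H false).
  by apply: (etrans (H true)); rewrite /dir_term yT.
rewrite ground_state_step// ground_stateE// enorm_step_powR// /dir_term.
rewrite -/(step_incr R i b x).
set V := 1 + a * _ * _ in V0 *.
have Vn : V != 0 by rewrite gt_eqF//; lra.
have Pn : r x `^ (2 * q) != 0 by rewrite gt_eqF// powR_gt0.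
set K := (X in X * _ `^ (q - 3)); move: (_ `^ (q - 3)) => G3.
move: (_ `^ (2 * p)) (_ `^ (2 * q)) Pn (_ `^ q) (_ `^ p) => P Q Q0 Gq Gp.
transitivity (P * (2^-1 * ((1 + Gp) * (V - (Gq + a * inv_norm R x ^+ 2 * (K * G3)))))).
  by field; rewrite Vn Q0.
by rewrite /V; ring.
Qed.

End HardyWeight.

(** * Asymptotic expansion of the weight up to a relative error O(rho^6) *)

Section Expansion.
Variables (R : realType) (d : nat) (p q : R).
Hypothesis pq : 4 * q = - (d%:R - 2 + 2 * p).
Implicit Types (x : 'rV[int]_d) (i : 'I_d).
Local Notation r := (enorm R).
Local Notation rho := (@inv_norm R d).
Local Notation sg := (@unit_quartic R d).

(* The value of the corrector that cancels the non-radial part of the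
   [rho ^+ 4] coefficient. *)
Definition corrector : R := - dir_k4 p q / (2 * d%:R + 2).

Definition second_coef : R :=
  2 * (d%:R * dir_k0 p q + dir_k2 p q - 6 * corrector).

Lemma sum_dir_pair_coef2 x : 0 < r x ->
  \sum_i dir_pair_coef p q corrector sg (unit_coord R i false) 2 x = 4 * q ^+ 2.
Proof.
move=> r0; rewrite /dir_pair_coef big_split /= sumr_const card_ord.
rewrite sumrN -mulr_sumr sum_unit_coord2// -(mulr_natr _ d).
(* The relation [pq] turns - 2 q d - 4 q (q - 1 + p) into 4 q^2. *)
have -> : d%:R = 2 - 2 * p - 4 * q :> R by rewrite pq; ring.
ring.
Qed.

(** The remaining [sg x] is the one in 4 q^2 rho^2 (1 + a sg rho^2), with a the corrector, so
    dividing by 1 + a sg rho^2 leaves a constant rho^4 coefficient. *)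
Lemma sum_dir_pair_coef4 x : 0 < r x ->
  \sum_i dir_pair_coef p q corrector sg (unit_coord R i false) 4 x =
  second_coef + corrector * sg x * (4 * q ^+ 2).
Proof.
move=> r0; rewrite /dir_pair_coef.
set k0 := dir_k0 p q; set k2 := dir_k2 p q; set k4 := dir_k4 p q.
set a := corrector; set m := q - 3.
rewrite (eq_bigr (fun i => (2 * k0 - 2 * a * sg x * m) +
  ((2 * k2 - 2 * a * (sg x * (2 * m * (m - 1 + p)) + 6)) *
     unit_coord R i false x ^+ 2 +
   (2 * k4 - 2 * a * (8 * m + 4 * p)) * unit_coord R i false x ^+ 4))); last first.
  by move=> i _; ring.
rewrite big_split /= sumr_const big_split /= card_ord -!mulr_sumr.
rewrite sum_unit_coord2// sum_unit_coord4 -(mulr_natr _ d).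
have d0 : 2 * d%:R + 2 != 0 :> R by rewrite gt_eqF// ltr_wpDl// mulr_ge0.
have k4E : k4 = - a * (2 * d%:R + 2).
  by rewrite /a /corrector -/k4; field.
rewrite k4E /second_coef -/k0 -/k2 -/a /m.
have -> : d%:R = 2 - 2 * p - 4 * q :> R by rewrite pq; ring.
ring.
Qed.

Lemma hardy_weight_expansion :
  exists C, forall x, 6 + 4 * `|corrector| <= r x ->
  `|hardy_weight (2 * p) (ground_state q corrector) x -
    (4 * q ^+ 2 * r x `^ (2 * p - 2) + second_coef * r x `^ (2 * p - 4))|
  <= C * r x `^ (2 * p - 6).
Proof.
set a := corrector; have a0 := normr_ge0 a.
pose D x := 6 + 4 * `|a| <= r x.
have D6 x : D x -> 6 <= r x by rewrite /D; lra.
have Dr0 x : D x -> 0 < r x by move/D6; lra.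
have rho01 x : D x -> `|rho x| <= 1.
  move=> Dx; rewrite ger0_norm ?invr_ge0 ?enorm_ge0// invf_le1 ?Dr0//.
  by have := D6 _ Dx; lra.
have bs : bounded_on D sg.
  exists 1 => x /Dr0 r0.
  by rewrite ger0_norm ?unit_quartic_ge0 ?unit_quartic_le1.
have jpair i : jet D rho 6
    (dir_pair_coef p q a sg (unit_coord R i false))
    (fun x => dir_term rho p q a sg (unit_coord R i false) x +
       dir_term rho p q a sg (fun x => - unit_coord R i false x) x).
  have by1 : bounded_on D (unit_coord R i false).
    by exists 1 => x /Dr0; exact: unit_coord_le1.
  have small x : D x ->
      `|2 * unit_coord R i false x * rho x + rho x ^+ 2| <= 2^-1.
    by move/D6; exact: step_incr_small.
  have small' x : D x ->
      `|2 * - unit_coord R i false x * rho x + rho x ^+ 2| <= 2^-1.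
    move/D6/(step_incr_small i true).
    by rewrite /step_incr /unit_coord expr1 expr0 mulN1r mul1r.
  apply: eq_jet (jetD (jet_dir rho01 p q a bs 6 by1 small)
    (jet_dir rho01 p q a bs 6 (bounded_onN by1) small')) _ _ => // k x k6 _.
  exact: dir_coef_pair.
have [C HC] := jet_remainder (jet_sum jpair).
(* The factor 2 pays for dividing by V = 1 + a sg rho^2 >= 1/2; the second summand bounds the rho^6
   term that appears when the claimed expansion is multiplied by V. *)
exists (2 * (C + `|a * second_coef|)) => x Dx.
have r0 := Dr0 _ Dx; have r6 := D6 _ Dx.
have r1 : 1 <= r x by lra.
have ra2 : 2 * `|a| <= r x ^+ 2 by move: Dx; rewrite /D; nra.
have V0 := corrector_ge r1 ra2.
have wE := hardy_weight_ground_state p q Dx.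
have rho0 : 0 <= rho x by rewrite invr_ge0 ltW.
have sumE (c : nat -> R) z : c 0 = 0 -> c 1 = 0 -> c 3 = 0 -> c 5 = 0 ->
    \sum_(k < 6) c k * z ^+ k = c 2 * z ^+ 2 + c 4 * z ^+ 4.
  move=> c0 c1 c3 c5; rewrite !big_ord_recr big_ord0 /= c0 c1 c3 c5.
  by rewrite !mul0r !addr0 !add0r.
have := HC x Dx.
rewrite (sumE (fun k => \sum_i dir_pair_coef p q a sg (unit_coord R i false) k x));
  try exact: big1.
rewrite sum_dir_pair_coef2// sum_dir_pair_coef4// [`|rho x|]ger0_norm// -/a.
move: wE; set w := hardy_weight _ _ _; set N := \sum_i _.
set V := 1 + _ * _ in V0 *; set A := second_coef; move=> wE HN.
rewrite !powR_enormB//; set P := r x `^ _ in wE *.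
have P0 : 0 <= P by exact: powR_ge0.
set X := w - _; set B := C + `|a * A|.
have XE : X * V = P * (N - (4 * q ^+ 2 * rho x ^+ 2 +
    (A + a * sg x * (4 * q ^+ 2)) * rho x ^+ 4) - a * A * sg x * rho x ^+ 6).
  by rewrite /X mulrBl wE /V; ring.
have Xle : `|X| * V <= P * (B * rho x ^+ 6).
  rewrite -[V]ger0_norm; last by lra.
  rewrite -normrM XE normrM ger0_norm// ler_wpM2l//.
  apply: (le_trans (ler_normB _ _)); rewrite /B (mulrDl C).
  apply: lerD; first exact: HN.
  rewrite normrM.
  rewrite [`|rho x ^+ 6|]ger0_norm ?exprn_ge0// ler_wpM2r ?exprn_ge0//.
  rewrite normrM ler_piMr// ger0_norm ?unit_quartic_ge0//.
  exact: unit_quartic_le1.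
have XV : `|X| * 2^-1 <= `|X| * V by rewrite ler_wpM2l.
have -> : 2 * B * (P * rho x ^+ 6) = 2 * (P * (B * rho x ^+ 6)) by ring.
lra.
Qed.

End Expansion.

(** * Sums with finite support *)

Section FiniteSums.
Variables (R : realType) (T : choiceType).
Implicit Types (f g : T -> R) (B : set T).

Lemma fsumT_restrict B f : (forall x, ~ B x -> f x = 0) ->
  \sum_(x \in [set: T]) f x = \sum_(x \in B) f x.
Proof.
by move=> f0; symmetry; apply: fsbig_widen => // x [_ /f0].
Qed.

Lemma ler_fsum B f g : finite_set B -> (forall x, f x <= g x) ->
  \sum_(x \in B) f x <= \sum_(x \in B) g x.
Proof. by move=> fB fg; rewrite !fsbig_finite//; exact: ler_sum. Qed.

End FiniteSums.

(** * The Hardy inequality by ground-state substitution *)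

Section HardyInequality.
Variables (R : realType) (d : nat).
Implicit Types (x y : 'rV[int]_d) (i : 'I_d) (b : bool) (u v : 'rV[int]_d -> R).
Local Notation r := (enorm R).
Local Notation lattice := 'rV[int]_d.

Lemma lattice_stepN i b : lattice_step i (~~ b) = - lattice_step i b.
Proof. by rewrite /lattice_step; case: b; rewrite /= ?opprK. Qed.

Lemma lattice_step_inj : injective (fun e : 'I_d * bool => lattice_step e.1 e.2).
Proof.
move=> [i b] [j c] /= /matrixP/(_ 0 i).
rewrite /lattice_step; case: b; case: c; rewrite !mxE !eqxx /=;
  by case: eqVneq => [->|].
Qed.

Lemma sum_lattice_adj (F : lattice -> R) x :
  \sum_(y \in [set y | lattice_adj x y]) F y =
  \sum_i \sum_b F (x + lattice_step i b).
Proof.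
have -> : [set y | lattice_adj x y] =
    (fun e : 'I_d * bool => x + lattice_step e.1 e.2) @` setT.
  apply/seteqP; split => y /=.
    by move=> [i [->|->]]; [exists (i, false)|exists (i, true)].
  by move=> [[i b] _ <-]; exists i; rewrite /lattice_step; case: b; [right|left].
rewrite fsbig_image; last first.
  by move=> e e' _ _ /addrI; exact: lattice_step_inj.
rewrite pair_bigA /= [RHS]fsbig_seq ?index_enum_uniq//.
apply: eq_fsbigl; apply/seteqP; split => // e _ /=.
exact: mem_index_enum.
Qed.

(** The difference of the two sides is a square over vs vt, and it vanishes when (s, t) is
    proportional to (vs, vt). *)
Lemma sq_sub_ge (s t vs vt : R) : 0 < vs -> 0 < vt ->
  s ^+ 2 * (1 - vt / vs) + t ^+ 2 * (1 - vs / vt) <= (s - t) ^+ 2.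
Proof.
move=> s0 t0; rewrite -subr_ge0.
have -> : (s - t) ^+ 2 - (s ^+ 2 * (1 - vt / vs) + t ^+ 2 * (1 - vs / vt)) =
    (s * vt - t * vs) ^+ 2 / (vs * vt).
  by field; rewrite !gt_eqF.
by rewrite divr_ge0 ?sqr_ge0// ltW// mulr_gt0.
Qed.

(** The energy gives the ordered edge (x, y) the conductance |x|^alpha / 2. After [sq_sub_ge] on
    each edge, the terms in u(y)^2 are moved to their own point by a translation, which symmetrises
    the conductances into those of [hardy_weight]. *)
Lemma hardy_inequality (alpha : R) v u :
  (forall x, 0 < v x) -> finite_set [set x | u x != 0] ->
  \sum_(x \in [set: lattice]) hardy_weight alpha v x * u x ^+ 2
    <= weighted_energy alpha u.
Proof.
move=> v0 fu; pose e i b := lattice_step i b.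
(* The support of [u] with its neighbours: a finite set outside which every summand vanishes. *)
pose B : set lattice := [set x | u x != 0] `|`
  \bigcup_(j in [set: 'I_d * bool]) ((fun x => x + e j.1 j.2) @` [set x | u x != 0]).
have fB : finite_set B.
  rewrite finite_setU; split=> //; apply: bigcup_finite => // j _.
  exact: finite_image.
have B0 x : ~ B x -> u x = 0.
  by move=> nB; apply/eqP/negPn/negP => ux; apply: nB; left.
have BS x i b : ~ B x -> u (x + e i b) = 0.
  move=> nB; apply/eqP/negPn/negP => ux; apply: nB; right.
  exists (i, ~~ b) => //=; exists (x + e i b) => //.
  by rewrite /e lattice_stepN addrK.
(* [cw] and [cw'] are the shares of the ordered edge (x, y) charged to x and to y. *)
pose cw x y := 2^-1 * r x `^ alpha * (u x ^+ 2 * (1 - v y / v x)).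
pose cw' x y := 2^-1 * r x `^ alpha * (u y ^+ 2 * (1 - v x / v y)).
have shift i b : \sum_(x \in [set: lattice]) cw' x (x + e i b) =
    \sum_(x \in [set: lattice]) cw' (x + e i (~~ b)) x.
  rewrite (@reindex_fsbigT _ _ _ _ _ (fun x => x + e i (~~ b))); last first.
    by exists (fun x => x - e i (~~ b)) => x; rewrite ?addrK ?subrK.
  by apply: eq_fsbigr => x _; rewrite /e lattice_stepN subrK.
have cw0 x y : ~ B x -> cw x y = 0.
  by move=> /B0 ux; rewrite /cw ux expr0n /= mul0r mulr0.
have cw'0 x i b : ~ B x -> cw' x (x + e i b) = 0.
  by move=> /BS ux; rewrite /cw' ux expr0n /= mul0r mulr0.
have cw'1 x y : ~ B x -> cw' y x = 0.
  by move=> /B0 ux; rewrite /cw' ux expr0n /= mul0r mulr0.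
have energyE x : r x `^ alpha * grad_sq u x =
    \sum_i \sum_b 2^-1 * r x `^ alpha * (u x - u (x + e i b)) ^+ 2.
  rewrite /grad_sq sum_lattice_adj mulrA [r x `^ alpha * _]mulrC mulr_sumr.
  by apply: eq_bigr => i _; rewrite mulr_sumr.
have weightE x : hardy_weight alpha v x * u x ^+ 2 =
    \sum_i \sum_b (cw x (x + e i b) + cw' (x + e i b) x).
  rewrite /hardy_weight mulr_suml; apply: eq_bigr => i _.
  rewrite mulr_suml; apply: eq_bigr => b _; rewrite /cw /cw' /e; ring.
rewrite /weighted_energy !(@fsumT_restrict _ _ B); last 2 first.
- move=> x nB; rewrite energyE big1// => i _; rewrite big1// => b _.
  by rewrite B0// BS// subrr expr0n mulr0.
- by move=> x nB; rewrite B0// expr0n mulr0.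
under [leLHS]eq_fsbigr do rewrite weightE.
under [leRHS]eq_fsbigr do rewrite energyE.
apply: (@le_trans _ _ (\sum_(x \in B) \sum_i \sum_b
    (cw x (x + e i b) + cw' x (x + e i b)))); last first.
  apply: ler_fsum => // x; apply: ler_sum => i _; apply: ler_sum => b _.
  rewrite /cw /cw' -mulrDr ler_wpM2l// ?mulr_ge0 ?powR_ge0// ?invr_ge0//.
  exact: sq_sub_ge.
have split_sum (F G : lattice -> 'I_d -> bool -> R) :
    \sum_(x \in B) \sum_i \sum_b (F x i b + G x i b) =
    \sum_(x \in B) \sum_i \sum_b F x i b + \sum_i \sum_b \sum_(x \in B) G x i b.
  rewrite !fsbig_finite//.
  rewrite (eq_bigr (fun x => \sum_i \sum_b F x i b + \sum_i \sum_b G x i b)).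
    rewrite big_split /=; congr (_ + _); rewrite exchange_big /=.
    apply: eq_bigr => i _; rewrite exchange_big /=.
    by apply: eq_bigr => b _; rewrite fsbig_finite.
  by move=> x _; rewrite -big_split; apply: eq_bigr => i _; rewrite -big_split.
(* The [cw] sums coincide; the [cw'] sums agree after a translation by the step, which exchanges the
   two signs. *)
rewrite !split_sum lerD2l le_eqVlt; apply/orP; left; apply/eqP.
apply: eq_bigr => i _.
have flip b : \sum_(x \in B) cw' (x + e i b) x =
    \sum_(x \in B) cw' x (x + e i (~~ b)).
  rewrite -(fsumT_restrict (f := fun x => cw' (x + e i b) x)); last first.
    by move=> x; exact: cw'1.
  rewrite -(fsumT_restrict (f := fun x => cw' x (x + e i (~~ b)))); last first.
    by move=> x; exact: cw'0.
  by have := shift i (~~ b); rewrite negbK => /esym.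
rewrite !big_bool; apply: etrans (congr2 +%R (flip true) (flip false)) _.
exact: addrC.
Qed.

End HardyInequality.

(* The value of [w] at 0 is never constrained: [w] stands for a function on
   the punctured lattice. *)
Theorem theorem6p1 (R : realType) (d : nat) (alpha : R)
    (hd : (2 <= d)%N) (halpha : 2 - d%:R < alpha) :
  exists (A : R) (w : 'rV[int]_d -> R),
    (forall u : 'rV[int]_d -> R, Cc_punctured u ->
       \sum_(x \in [set x : 'rV[int]_d | x != 0]) w x * u x ^+ 2
         <= weighted_energy alpha u) /\
    bigO_at_infty
      (fun x : 'rV[int]_d =>
         w x - ((d%:R - 2 + alpha) ^+ 2 / 4 * enorm R x `^ (alpha - 2)
                + A * enorm R x `^ (alpha - 4)))
      (fun x : 'rV[int]_d => enorm R x `^ (alpha - 6)).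
Proof.
(* Half exponents: alpha = 2 p and beta = 2 q. *)
pose p := alpha / 2; pose q := - (d%:R - 2 + alpha) / 4.
have pE : alpha = 2 * p by rewrite /p; field.
have qE : 4 * q = - (d%:R - 2 + 2 * p) by rewrite -pE /q; field.
have HE : (d%:R - 2 + alpha) ^+ 2 / 4 = 4 * q ^+ 2 by rewrite /q; field.
pose a := corrector d p q.
pose w : 'rV[int]_d -> R := hardy_weight alpha (ground_state q a).
exists (second_coef d p q), w; split.
  move=> u [fu u0].
  apply: le_trans (hardy_inequality alpha (ground_state_gt0 q a) fu).
  (* Including the origin in the sum adds nothing, since u vanishes there. *)
  rewrite le_eqVlt; apply/orP; left; apply/eqP/fsbig_widen => // x [_ /= x0].
  have -> : x = 0 by apply/eqP/negPn/negP.
  by rewrite u0 expr0n mulr0.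
have [C HC] := hardy_weight_expansion qE.
exists C, (6 + 4 * `|a|) => x Mx.
by rewrite (ger0_norm (powR_ge0 _ _)) HE /w pE; exact: HC.
Qed.
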